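(* Let $1<p<m$ with $p\mid m$, and $N\ge2$. For the group $G(m,p,N)$ let $1\le t\le\frac mp-1$, $0\le s\le p-1$ and let $g$ be any polynomial in $y=(x_1^m,\dots,x_N^m)$. Then for $1\le i\le N$ $$T_i(\kappa)^{m/p}\,x^{(t+sm/p)v}g(y)=x^{tv}\,T_i(\kappa')^{m/p}\,x^{(sm/p)v}g(y),$$ where $v=(1,1,\dots,1)\in\mathbb{N}^N$, $\kappa=(\kappa_0,\kappa_1,\dots,\kappa_{m/p-1})$ and $$\kappa'=\left(\kappa_0,\kappa_1+\tfrac1p,\dots,\kappa_t+\tfrac1p,\kappa_{t+1},\dots,\kappa_{m/p-1}\right).$$
   Context: $\eta=e^{2\pi\mathrm{i}/m}$, $x=(x_1,\dots,x_N)$, $x^\alpha=\prod x_i^{\alpha_i}$ (so $x^{tv}=(x_1\cdots x_N)^t$). $w\in S_N$ acts on polynomials by $w(x^\alpha)=x^{w\alpha}$, $(w\alpha)_i=\alpha_{w^{-1}(i)}$; $(i,j)$ is the transposition; $\tau_i$ acts by $\tau_ix^\alpha=\eta^{\alpha_i}x^\alpha$. For a full parameter tuple $(\kappa_0,\dots,\kappa_{m-1})$, $$T_i=\frac{\partial}{\partial x_i}+\kappa_0\sum_{j\ne i}\sum_{r=0}^{m-1}\frac{1-\tau_i^{-r}(i,j)\tau_i^r}{x_i-\eta^rx_j}+\sum_{u=1}^{m-1}\kappa_u\sum_{r=0}^{m-1}\frac{\eta^{-ru}\tau_i^r}{x_i}$$ on polynomials in $x$ (divisions after applying numerators). $G(m,p,N)$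 is the group of $N\times N$ permutation matrices with nonzero entries replaced by $m$-th roots of unity whose product is an $(m/p)$-th root of unity. For $G(m,p,N)$ the parameters are $\kappa=(\kappa_0,\kappa_1,\dots,\kappa_{m/p-1})$, and $T_i(\kappa)$ means the operator $T_i$ for the full tuple obtained by setting $\kappa_{rm/p}=0$ and $\kappa_{u+rm/p}=\kappa_u$ for $1\le r\le p-1$ and $1\le u\le\frac mp-1$; likewise for $\kappa'$. *)

(* Defs.v *)
From HB Require Import structures.
From mathcomp Require Import all_boot all_order all_fingroup all_algebra.
From mathcomp Require Import ring lra.
From mathcomp Require Export mpoly complex.
(* The notations of MathComp-Analysis clash with those of mpoly. *)
From mathcomp Require Export -(notations) boolp classical_sets reals trigo.

Set Implicit Arguments.
Unset Strict Implicit.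
Unset Printing Implicit Defensive.

Import Order.TTheory GRing.Theory Num.Theory.
Local Open Scope ring_scope.
Local Open Scope complex_scope.

(* exp(2 pi i / m) *)
Definition eta (R : realType) (m : nat) : R[i] :=
  cos (2 * pi / m%:R) +i* sin (2 * pi / m%:R).

Section Operators.
Variables (C : fieldType) (N : nat).
Implicit Types (f d : {mpoly C[N]}) (z : C) (i j : 'I_N).

(* The q with f = q * d if there is one, and 0 otherwise; when d != 0 such a
   q is unique (exquoK). *)
Definition exquo f d : {mpoly C[N]} := xget 0 (fun q => f = q * d).

(* For k in Z, the k-th power of tau_i, where tau_i x^a = z^(a i) x^a.  The
   action of a permutation w is msym w, which sends x_k to x_(w k), that is
   x^a to x^(w a) with (w a)_k = a_(w^-1 k). *)
Definition tau z i (k : int) f : {mpoly C[N]} :=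
  \sum_(a <- msupp f) (f@_a * z ^ (k * (a i)%:Z)) *: 'X_[a].

(* (1 - tau_i^-r (i,j) tau_i^r) f *)
Definition swap_num z i j (r : nat) f : {mpoly C[N]} :=
  f - tau z i (- r%:Z) (msym (tperm i j) (tau z i r%:Z f)).

(* \sum_r z^(- r u) tau_i^r f: only this sum, not each of its terms, is
   divisible by x_i. *)
Definition twist_num z (m : nat) i (u : nat) f : {mpoly C[N]} :=
  \sum_(r < m) z ^ (- (r * u)%:Z) *: tau z i r%:Z f.

(* T_i for the full parameter tuple (kappa_0, ..., kappa_(m-1)). *)
Definition dunkl z (m : nat) (kappa : m.-tuple C) i f : {mpoly C[N]} :=
  f^`M(i)
  + kappa`_0 *: (\sum_(j < N | j != i) \sum_(r < m)
                   exquo (swap_num z i j r f) ('X_i - z ^+ r *: 'X_j))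
  + \sum_(1 <= u < m) kappa`_u *: exquo (twist_num z m i u f) 'X_i.

Definition allones : 'X_{1..N} := [multinom 1%N | _ < N].

(* g(x_1^m, ..., x_N^m) *)
Definition in_powers (m : nat) (g : {mpoly C[N]}) : {mpoly C[N]} :=
  g \mPo [tuple 'X_j ^+ m | j < N].

Lemma exquoK f d : d != 0 -> exquo (f * d) d = f.
Proof.
move=> d0; rewrite /exquo; case: xgetP => [q _ e|/(_ f)].
  by apply: (mulIf d0); rewrite -e.
by case.
Qed.

End Operators.

(* The full tuple for G(m,p,N): kappa_(r m/p) = 0 and
   kappa_(u + r m/p) = kappa_u for r >= 1. *)
Definition full_param (C : fieldType) (m p : nat) (kappa : (m %/ p).-tuple C) :
    m.-tuple C :=
  [tuple if u == 0 :> nat then kappa`_0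
         else if (m %/ p %| u)%N then 0
         else kappa`_(u %% (m %/ p)) | u < m].

Definition shift_param (C : fieldType) (m p t : nat)
    (kappa : (m %/ p).-tuple C) : (m %/ p).-tuple C :=
  [tuple if (1 <= u <= t)%N then tnth kappa u + p%:R^-1 else tnth kappa u
     | u < m %/ p].

Arguments full_param {C} m p kappa.
Arguments shift_param {C} m p t kappa.
Arguments allones {N}.

(* The quotients in dunkl are exact. *)
Section Divisibility.
Variables (C : fieldType) (N : nat) (z : C).
Implicit Types (f d : {mpoly C[N]}) (i j : 'I_N).

Lemma tauE i k f :
  tau z i k f = f \mPo [tuple if j == i then z ^ k *: 'X_j else 'X_j | j < N].
Proof.
rewrite comp_mpolyE; apply: eq_bigr => a _; rewrite -scalerA; congr (_ *: _).
rewrite mpolyXE_id (bigD1 i) //= [in RHS](bigD1 i) //= tnth_mktuple eqxx.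
rewrite exprZn exprnP -exprz_exp exprnP -!exprnP -scalerAl; congr (_ *: (_ * _)).
by apply: eq_bigr => j /negPf ji; rewrite tnth_mktuple ji.
Qed.

Lemma swap_num_dvd i j r f : z != 0 -> j != i ->
  exists q, swap_num z i j r f = q * ('X_i - z ^+ r *: 'X_j).
Proof.
move=> z0 ji; rewrite /swap_num; set d := 'X_i - _.
have zr0 : z ^+ r != 0 by rewrite expf_neq0.
pose sg f := tau z i (- r%:Z) (msym (tperm i j) (tau z i r%:Z f)).
rewrite -[tau _ _ _ _]/(sg f).
have sgD : {morph sg : f g / f + g} by move=> f1 f2; rewrite /sg !tauE !raddfD.
have sgM : {morph sg : f g / f * g} by move=> f1 f2; rewrite /sg !tauE !rmorphM.
have sgC c : sg c%:MP = c%:MP.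
  by rewrite /sg !tauE comp_mpolyC /msym mmapC comp_mpolyC.
have sgX k : exists q, 'X_k - sg 'X_k = q * d.
  rewrite /sg !tauE comp_mpolyXU -tnth_nth tnth_mktuple.
  have [->|ki] := eqVneq k i.
    rewrite msymZ /msym mmapX mmap1U tpermL comp_mpolyZ comp_mpolyXU.
    rewrite -tnth_nth tnth_mktuple (negPf ji).
    by exists 1; rewrite mul1r.
  rewrite /msym mmapX mmap1U.
  have [->|kj] := eqVneq k j.
    rewrite tpermR comp_mpolyXU -tnth_nth tnth_mktuple eqxx; exists (- (z ^ (- r%:Z))%:MP).
    rewrite -exprz_inv -exprnP exprVn mulNr mulrBr -!mul_mpolyC mulrA.
    by rewrite -mpolyCM mulVf // mpolyC1 mul1r opprB.
  rewrite tpermD 1?eq_sym // comp_mpolyXU -tnth_nth tnth_mktuple (negPf ki).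
  by exists 0; rewrite mul0r; apply: subrr.
have PM f1 f2 : (exists q, f1 - sg f1 = q * d) -> (exists q, f2 - sg f2 = q * d) ->
   exists q, f1 * f2 - sg (f1 * f2) = q * d.
  move=> [q1 e1] [q2 e2]; exists (q1 * f2 + sg f1 * q2).
  rewrite mulrDl mulrAC -(mulrA (sg f1)) -e1 -e2 sgM.
  by rewrite mulrBl mulrBr addrA subrK.
have PC c : exists q, c%:MP - sg c%:MP = q * d.
  by exists 0; rewrite sgC mul0r subrr.
apply: (mpolyind (P := fun f => exists q, f - sg f = q * d)) => [|c a p _ _ [q eq]].
  by have [q] := PC 0; exists q; rewrite -mpolyC0.
have [q' eq'] : exists q, c *: 'X_[a] - sg (c *: 'X_[a]) = q * d.
  rewrite -mul_mpolyC; apply: (PM) => //; rewrite mpolyXE_id.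
  apply: (big_ind (fun h => exists q, h - sg h = q * d)) => //.
  by rewrite -mpolyC1.
  move=> k _; elim: (a k) => [|n IH]; first by rewrite expr0 -mpolyC1.
  by rewrite exprS; apply: (PM).
by exists (q' + q); rewrite sgD mulrDl -eq -eq' opprD addrACA.
Qed.

Lemma twist_num_dvd m i u f : m.-primitive_root z -> (0 < u < m)%N ->
  exists q, twist_num z m i u f = q * 'X_i.
Proof.
move=> zm /andP[u0 um].
have tw0 : twist_num z m i u f =
  \sum_(a <- msupp f) (f@_a * \sum_(r < m) z ^ (r%:Z * ((a i)%:Z - u%:Z))) *: 'X_[a].
  rewrite /twist_num /tau; under eq_bigr do rewrite scaler_sumr.
  rewrite exchange_big; apply: eq_bigr => a _ /=.
  rewrite mulr_sumr scaler_suml; apply: eq_bigr => r _.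
  rewrite scalerA; congr (_ *: _); rewrite mulrCA; congr (_ * _).
  have z0 : z != 0 by rewrite (prim_root_eq0 zm) -lt0n (prim_order_gt0 zm).
  by rewrite -expfzDr //; congr (z ^ _); rewrite PoszM mulrBr addrC.
rewrite tw0; apply: (big_ind (fun f => exists q, f = q * 'X_i)).
- by exists 0; rewrite mul0r.
- by move=> f1 f2 [q1 ->] [q2 ->]; exists (q1 + q2); rewrite mulrDl.
move=> a _; have [ai0|ai] := eqVneq (a i) 0%N; last first.
  exists ((f@_a * \sum_(r < m) z ^ (r%:Z * ((a i)%:Z - u%:Z))) *: 'X_[(a - U_(i))%MM]).
  by rewrite -scalerAl -mpolyXD submK // lep1mP.
exists 0; rewrite mul0r ai0 sub0r.
suff -> : \sum_(r < m) z ^ (r%:Z * - u%:Z) = 0 by rewrite mulr0 scale0r.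
under eq_bigr => r _ do rewrite mulrC -exprz_exp -exprnP.
set w := z ^ _.
have w1 : w != 1.
  rewrite /w -exprz_inv -exprnP exprVn invr_eq1 -(prim_order_dvd zm).
  by rewrite gtnNdvd.
apply: (@mulfI _ (w - 1)); first by rewrite subr_eq0.
rewrite mulr0 -subrX1 /w -exprz_inv -exprnP exprVn exprVn -exprM mulnC exprM.
by rewrite (prim_expr_order zm) expr1n invr1 subrr.
Qed.
End Divisibility.

Lemma eta_prim (R : realType) (m : nat) : (0 < m)%N -> m.-primitive_root (eta R m).
Proof.
move=> m0; have mR : 0 < m%:R :> R by rewrite ltr0n.
set th : R := 2 * pi / m%:R.
have etaX k : eta R m ^+ k = cos (th *+ k) +i* sin (th *+ k).
  elim: k => [|k IH]; first by rewrite expr0 mulr0n cos0 sin0.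
  rewrite exprS IH /eta -/th mulrS cosD sinD.
  by apply/eqP; rewrite eq_complex /= eqxx addrC eqxx.
apply/andP; split => //; apply/forallP => k; apply/eqP.
rewrite unity_rootE etaX.
pose x : R := pi * (k.+1%:R / m%:R).
have -> : th *+ k.+1 = x *+ 2.
  by rewrite -mulr_natr /th /x -[RHS]mulr_natr; ring.
have [km|km] := eqVneq k.+1 m.
  have -> : x = pi by rewrite /x km mulfV ?mulr1 // lt0r_neq0.
  by rewrite cos2pi sin_mulr2n sinpi mulr0 mul0rn; apply/eqP.
have km' : (k.+1 < m)%N by rewrite ltn_neqAle km ltn_ord.
apply/negP => /eqP[] /eqP; rewrite cos_mulr2n cos2sin2 => c _.
have : 0 < sin x.
  apply: sin_gt0_pi; rewrite /x mulr_gt0 ?pi_gt0 ?divr_gt0 ?ltr0n //=.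
  by rewrite gtr_pMr ?pi_gt0 // ltr_pdivrMr // mul1r ltr_nat.
have /eqP : sin x ^+ 2 = 0 by move/eqP: c; lra.
by rewrite sqrf_eq0 => /eqP ->; rewrite ltxx.
Qed.

(* Main.v *)
Require Import Defs.
From mathcomp Require Import all_boot all_order all_fingroup all_algebra.
From mathcomp Require Import ring zify.

(* Write v = (1, ..., 1) and x^m = (x_1^m, ..., x_N^m).  As long as k < m,
   T_i maps x^(e v) x_i^(-k) F(x^m) to x^(e v) x_i^(-k-1) (L F + c_k F)(x^m),
   where L is m x_i times the type A Dunkl operator with parameter kappa_0 and
   c_k = e - k + m kappa_u for u = e - k modulo m (without the kappa_u term if
   m | e - k).  Hence x_i^(m/p) T_i^(m/p) x^(e v) g(x^m) is x^(e v) times the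
   product of the L + c_k for k < m/p applied to g.  These factors commute,
   and the shift of kappa is such that the c_k for (e, kappa) = (t + s m/p,
   kappa) are, up to rotation by t, those for (s m/p, kappa'). *)

Set Implicit Arguments.
Unset Strict Implicit.
Unset Printing Implicit Defensive.

Import GRing.Theory Num.Theory.
Local Open Scope ring_scope.
Local Open Scope complex_scope.

(** * Sums over powers of a primitive root of unity *)

Lemma prim_root_neq0 (C : fieldType) (m : nat) (z : C) :
  m.-primitive_root z -> z != 0.
Proof. by move=> zm; rewrite (prim_root_eq0 zm) -lt0n (prim_order_gt0 zm). Qed.

(** The sum is geometric in w = z^(a-u), where w = 1 exactly when a = u modulo m. Otherwise (w - 1)
    times the sum is w^m - 1 = 0. *)
Lemma sum_prim_root (C : fieldType) (m : nat) (z : C) (a u : nat) :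
  m.-primitive_root z ->
  \sum_(r < m) z ^ (r%:Z * (a%:Z - u%:Z)) = if a == u %[mod m] then m%:R else 0.
Proof.
move=> zm; have z0 := prim_root_neq0 zm.
under eq_bigr => r _ do rewrite mulrC -exprz_exp -exprnP.
have e1 : (z ^ (a%:Z - u%:Z) == 1) = (a == u %[mod m]).
  rewrite expfzDr // -exprz_inv -!exprnP exprVn.
  rewrite -(eq_prim_root_expr zm) -subr_eq0 -[RHS]subr_eq0.
  rewrite -(inj_eq (mulIf (expf_neq0 u z0))) mulrBl mulfVK ?expf_neq0 //.
  by rewrite mul1r mul0r.
case: ifP => au.
  move: e1; rewrite au => /eqP ->.
  by under eq_bigr do rewrite expr1n; rewrite sumr_const card_ord.
have w1 : z ^ (a%:Z - u%:Z) != 1 by rewrite e1 au.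
apply: (@mulfI _ (z ^ (a%:Z - u%:Z) - 1)); first by rewrite subr_eq0.
rewrite mulr0 -subrX1 exprnP exprz_exp mulrC -exprz_exp -exprnP.
by rewrite (prim_expr_order zm) exp1rz subrr.
Qed.

Lemma mkseqD (T : Type) (f : nat -> T) a b :
  mkseq f (a + b) = mkseq f a ++ mkseq (fun k => f (a + k)%N) b.
Proof. by rewrite /mkseq iotaD map_cat add0n -{2}[a]addn0 iotaDl -map_comp. Qed.

(** * Substitution of x_j^m for x_j *)

Section DunklOnPowers.
Variables (C : fieldType) (N : nat).
Implicit Types (f F G : {mpoly C[N]}) (i j : 'I_N) (z c : C).

Lemma in_powersD m F G :
  in_powers m (F + G) = in_powers m F + in_powers m G :> {mpoly C[N]}.
Proof. exact: raddfD. Qed.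

Lemma in_powersM m F G :
  in_powers m (F * G) = in_powers m F * in_powers m G :> {mpoly C[N]}.
Proof. exact: rmorphM. Qed.

Lemma in_powersZ m c F : in_powers m (c *: F) = c *: in_powers m F.
Proof. exact: comp_mpolyZ. Qed.

Lemma in_powersX m (a : 'X_{1..N}) :
  in_powers m 'X_[a] = 'X_[(a *+ m)%MM] :> {mpoly C[N]}.
Proof.
rewrite /in_powers comp_mpolyX mpolyXE_id; apply: eq_bigr => j _.
by rewrite tnth_mktuple -exprM mulmnE mulnC.
Qed.

Lemma in_powersXU m j : in_powers m 'X_j = 'X_j ^+ m :> {mpoly C[N]}.
Proof. by rewrite in_powersX mpolyXn. Qed.

Lemma mulX_mderivX i (a : 'X_{1..N}) :
  'X_i * 'X_[a]^`M(i) = (a i)%:R *: 'X_[a] :> {mpoly C[N]}.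
Proof.
rewrite mderivX -scalerAr; have [->|ai] := eqVneq (a i) 0%N.
  by rewrite !scale0r.
by rewrite -mpolyXD addmC submK // lep1mP.
Qed.

(** On a monomial, x_i d/dx_i multiplies by the exponent of x_i, and the substitution multiplies
    that exponent by m. *)
Lemma mulX_mderiv_in_powers m i F :
  'X_i * (in_powers m F)^`M(i) = m%:R *: in_powers m ('X_i * F^`M(i)).
Proof.
elim/mpolyind: F => [|c a p _ _ IH].
  by rewrite mderiv0 mulr0 /in_powers raddf0 mderiv0 mulr0 scaler0.
rewrite in_powersD !mderivD !mulrDr in_powersD scalerDr -IH; congr (_ + _).
rewrite in_powersZ !mderivZ -!scalerAr in_powersX !mulX_mderivX mulmnE.
by rewrite !in_powersZ in_powersX !scalerA; congr (_ *: _); ring.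
Qed.

(** * Action of tau_i, permutations and reflections *)

Lemma tauD z i k : {morph @tau C N z i k : f F / f + F}.
Proof. by move=> f F; rewrite !tauE raddfD. Qed.

Lemma tauM z i k : {morph @tau C N z i k : f F / f * F}.
Proof. by move=> f F; rewrite !tauE rmorphM. Qed.

Lemma tauZ z i k c f : tau z i k (c *: f) = c *: tau z i k f.
Proof. by rewrite !tauE comp_mpolyZ. Qed.

Lemma tauX z i k (a : 'X_{1..N}) :
  tau z i k 'X_[a] = z ^ (k * (a i)%:Z) *: 'X_[a] :> {mpoly C[N]}.
Proof. by rewrite /tau msuppX big_seq1 mcoeffX eqxx mul1r. Qed.

Lemma tau_in_powers z m i k F : z ^+ m = 1 ->
  tau z i k (in_powers m F) = in_powers m F.
Proof.
move=> zm; elim/mpolyind: F => [|c a p _ _ IH].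
  by rewrite /in_powers raddf0 tauE raddf0.
rewrite in_powersD tauD IH; congr (_ + _).
rewrite in_powersZ in_powersX tauZ tauX mulmnE mulnC PoszM mulrCA.
by rewrite -exprz_exp -exprnP zm exp1rz scale1r.
Qed.

Lemma msym_in_powers m (w : 'S_N) F :
  msym w (in_powers m F) = in_powers m (msym w F).
Proof.
elim/mpolyind: F => [|c a p _ _ IH].
  by rewrite /in_powers !raddf0.
rewrite in_powersD !msymD in_powersD IH; congr (_ + _).
rewrite !(msymZ, in_powersZ) msymX !in_powersX msymX.
by congr (_ *: 'X_[_]); apply/mnmP => k; rewrite mulmnE !mnmE mulmnE.
Qed.

Lemma msym_allones (w : 'S_N) e :
  msym w 'X_[(allones *+ e)%MM] = 'X_[(allones *+ e)%MM] :> {mpoly C[N]}.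
Proof.
by rewrite msymX; congr 'X_[_]; apply/mnmP => k; rewrite mnmE !mulmnE !mnmE.
Qed.

Lemma msymXn (w : 'S_N) i k : msym w ('X_i ^+ k) = 'X_(w i) ^+ k :> {mpoly C[N]}.
Proof. by rewrite rmorphXn /= /msym mmapX mmap1U. Qed.

(** Unlike [swap_num], this is multiplicative, so its value on f can be read off from a product
    formula for f. *)
Definition twisted_swap z i j (r : nat) f : {mpoly C[N]} :=
  tau z i (- r%:Z) (msym (tperm i j) (tau z i r%:Z f)).

Lemma twisted_swapM z i j r : {morph twisted_swap z i j r : f F / f * F}.
Proof. by move=> f F; rewrite /twisted_swap tauM msymM tauM. Qed.

Lemma twisted_swap_in_powers z m i j r F : z ^+ m = 1 ->
  twisted_swap z i j r (in_powers m F) = in_powers m (msym (tperm i j) F).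
Proof.
by move=> zm; rewrite /twisted_swap tau_in_powers // msym_in_powers tau_in_powers.
Qed.

(** As all exponents equal e, the two [tau] contribute the inverse scalars z^(re) and z^(-re). *)
Lemma twisted_swap_allones z i j r e : z != 0 ->
  twisted_swap z i j r 'X_[(allones *+ e)%MM] = 'X_[(allones *+ e)%MM].
Proof.
move=> z0; rewrite /twisted_swap tauX msymZ msym_allones tauZ tauX scalerA.
by rewrite -expfzDr // mulNr subrr scale1r.
Qed.

Lemma twisted_swapXn z i j r k : j != i ->
  twisted_swap z i j r ('X_i ^+ k) = z ^+ (r * k) *: 'X_j ^+ k.
Proof.
move=> ji; rewrite /twisted_swap mpolyXn tauX -mpolyXn msymZ msymXn tpermL tauZ.
rewrite mpolyXn tauX -mpolyXn !mulmnE !mnm1E eqxx (negPf ji) mul0n mulr0.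
by rewrite mul1n scale1r -PoszM.
Qed.

(** * Divided differences and the operator L *)

Lemma mpolyX_sub_neq0 z i j : j != i -> 'X_i - z *: 'X_j != 0 :> {mpoly C[N]}.
Proof.
move=> ji; apply/eqP => /(congr1 (mcoeff U_(i))).
rewrite mcoeffB mcoeffZ !mcoeffX eqxx mcoeff0.
case: eqP => [/mnmP/(_ i)|_]; first by rewrite !mnm1E eqxx (negPf ji).
by rewrite mulr0 subr0 => /eqP; rewrite oner_eq0.
Qed.

Lemma mpolyX_expB_neq0 (m : nat) i j : (0 < m)%N -> j != i ->
  'X_i ^+ m - 'X_j ^+ m != 0 :> {mpoly C[N]}.
Proof.
move=> m0 ji; rewrite !mpolyXn; apply/eqP => /(congr1 (mcoeff (U_(i) *+ m)%MM)).
rewrite mcoeffB !mcoeffX eqxx mcoeff0.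
case: eqP => [/mnmP/(_ i)|_].
  by rewrite !mulmnE !mnm1E eqxx (negPf ji) mul0n mul1n => m00; rewrite -m00 in m0.
by move/eqP; rewrite subr0 oner_eq0.
Qed.

Lemma exquo_mul f d : (exists q, f = q * d) -> exquo f d * d = f.
Proof.
by move=> [q ->]; have [->|d0] := eqVneq d 0; rewrite ?mulr0 // exquoK.
Qed.

Lemma tau1 i k f : tau 1 i k f = f.
Proof. by rewrite [RHS]mpolyE /tau; apply: eq_bigr => a _; rewrite exp1rz mulr1. Qed.

Definition divided_diff i j F : {mpoly C[N]} :=
  exquo (F - msym (tperm i j) F) ('X_i - 'X_j).

Lemma divided_diffK i j F : j != i ->
  divided_diff i j F * ('X_i - 'X_j) = F - msym (tperm i j) F.
Proof.
move=> ji; apply: exquo_mul.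
(* At z = 1 each [tau] is the identity and [swap_num] is F - (i,j)F. *)
have [q] := swap_num_dvd 0 F (oner_neq0 C) ji.
by rewrite /swap_num !tau1 expr0 scale1r; exists q.
Qed.

Lemma divided_diff_linear i j c F G : j != i ->
  divided_diff i j (c *: F + G) = c *: divided_diff i j F + divided_diff i j G.
Proof.
move=> ji; have := mpolyX_sub_neq0 (1 : C) ji; rewrite scale1r => d0.
have dK := divided_diffK _ ji.
apply: (mulIf d0); rewrite dK msymD msymZ; move: (dK F) (dK G).
move: (divided_diff i j F) (divided_diff i j G) => A B dA dB.
by rewrite mulrDl -scalerAl dA dB scalerBr opprD addrACA.
Qed.

(** This is L. The factor m has two sources: on polynomials in x^m, x_i d/dx_i becomes m times
    itself in the new variables, and for each j the m reflection quotients add up to m times one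
    divided difference term. *)
Definition euler m c i F : {mpoly C[N]} :=
  m%:R *: ('X_i * (F^`M(i) + c *: \sum_(j < N | j != i) divided_diff i j F)).

Lemma euler_linear m b i c F G :
  euler m b i (c *: F + G) = c *: euler m b i F + euler m b i G.
Proof.
rewrite /euler; under eq_bigr => j ji do rewrite divided_diff_linear //.
rewrite big_split /= -scaler_sumr mderivD mderivZ.
move: (\sum_(j < N | _) _) (\sum_(j < N | _) _) F^`M(i) G^`M(i) => A B A' B'.
by rewrite -!mul_mpolyC; ring.
Qed.

(** * One application of T_i *)

Lemma sum_geometric z m i j k : m.-primitive_root z -> (k < m)%N ->
  \sum_(r < m) z ^ (- (r * k)%:Z) *:
     (\sum_(l < m) 'X_i ^+ (m.-1 - l) * (z ^+ r *: 'X_j) ^+ l)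
  = m%:R *: ('X_i ^+ (m.-1 - k) * 'X_j ^+ k) :> {mpoly C[N]}.
Proof.
move=> zm km; have z0 := prim_root_neq0 zm.
under eq_bigr do rewrite scaler_sumr.
(* The coefficient of x_i^(m-1-l) x_j^l is the sum over r of z^(r(l-k)); since l, k < m, only l = k
   survives. *)
rewrite exchange_big /= (eq_bigr (fun l : 'I_m =>
    (if l == Ordinal km then m%:R else 0) *: ('X_i ^+ (m.-1 - l) * 'X_j ^+ l))).
  rewrite (bigD1 (Ordinal km)) //= eqxx big1 ?addr0 // => l /negPf ->.
  by rewrite scale0r.
move=> l _; transitivity (\sum_(r < m) z ^ (r%:Z * (l%:Z - k%:Z)) *:
    ('X_i ^+ (m.-1 - l) * 'X_j ^+ l : {mpoly C[N]})).
  apply: eq_bigr => r _; rewrite exprZn -scalerAr scalerA -exprM exprnP -expfzDr //.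
  by congr (z ^ _ *: _); rewrite !PoszM; ring.
by rewrite -scaler_suml sum_prim_root // !modn_small.
Qed.

(* The last hypothesis says f = x^(e v) x_i^(-k) F(x^m), with x_i^k multiplied
   out so that everything stays polynomial. *)
Lemma sum_swap_quotients z m i j e k f F :
    m.-primitive_root z -> (k < m)%N -> j != i ->
    f * 'X_i ^+ k = 'X_[(allones *+ e)%MM] * in_powers m F ->
  (\sum_(r < m) exquo (swap_num z i j r f) ('X_i - z ^+ r *: 'X_j)) * 'X_i ^+ k.+1
  = 'X_[(allones *+ e)%MM] * in_powers m (m%:R *: ('X_i * divided_diff i j F)).
Proof.
move=> zm km ji fE; set W := 'X_[(_ *+ _)%MM] in fE *.
have m0 := prim_order_gt0 zm; have zm1 := prim_expr_order zm.
have z0 := prim_root_neq0 zm.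
have X0 (l : 'I_N) n : 'X_l ^+ n != 0 :> {mpoly C[N]}.
  by rewrite expf_neq0 // -[_ == 0]msupp_eq0 msuppX.
(* The factor x_i^m - x_j^m is a common multiple of the divisors x_i - z^r x_j, and x_j^k clears the
   x_j^(-k) into which the reflection turns x_i^(-k). *)
apply: (mulIf (X0 j k)); apply: (mulIf (mpolyX_expB_neq0 m0 ji)).
pose E r : {mpoly C[N]} := \sum_(l < m) 'X_i ^+ (m.-1 - l) * (z ^+ r *: 'X_j) ^+ l.
have EE r : 'X_i ^+ m - 'X_j ^+ m = ('X_i - z ^+ r *: 'X_j) * E r.
  by rewrite /E -subrXX exprZn exprAC zm1 expr1n scale1r.
have swE r : z ^+ (r * k) *: (twisted_swap z i j r f * 'X_j ^+ k)
    = W * in_powers m (msym (tperm i j) F).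
  have := congr1 (twisted_swap z i j r) fE.
  rewrite (twisted_swapM z i j r f) (twisted_swapM z i j r W).
  rewrite twisted_swap_allones // twisted_swap_in_powers //.
  by rewrite twisted_swapXn // -scalerAr.
(* The exponent r * 0 makes both sums over r instances of sum_geometric. *)
have term r : exquo (swap_num z i j r f) ('X_i - z ^+ r *: 'X_j) *
    'X_i ^+ k.+1 * 'X_j ^+ k * ('X_i ^+ m - 'X_j ^+ m) =
  W * in_powers m F * 'X_i * 'X_j ^+ k * (z ^ (- (r * 0)%:Z) *: E r)
  - W * in_powers m (msym (tperm i j) F) * 'X_i ^+ k.+1 * (z ^ (- (r * k)%:Z) *: E r).
  rewrite muln0 scale1r -scalerAr -(swE r) -!scalerAl !scalerA.
  rewrite (exprnP z (r * k)) -expfzDr // addNr scale1r -fE.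
  have := exquo_mul (swap_num_dvd r f z0 ji).
  rewrite /swap_num -/(twisted_swap z i j r f) (EE r).
  set q := exquo _ _; set d := 'X_i - _; set s := twisted_swap _ _ _ _ _.
  move=> qd; transitivity (q * d * ('X_i ^+ k.+1 * 'X_j ^+ k * E r)); first by ring.
  by rewrite qd exprS; ring.
rewrite !mulr_suml; under eq_bigr => r _ do rewrite term.
rewrite sumrB -!mulr_sumr !sum_geometric // subn0 expr0 mulr1.
rewrite in_powersZ in_powersM in_powersXU.
have ddE : in_powers m (divided_diff i j F) * ('X_i ^+ m - 'X_j ^+ m)
     = in_powers m F - in_powers m (msym (tperm i j) F).
  rewrite -!in_powersXU -[- in_powers _ 'X_j]raddfN -[- in_powers _ (msym _ _)]raddfN.
  by rewrite -!in_powersD -in_powersM divided_diffK.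
rewrite -!scalerAr -!scalerAl -scalerBr; congr (_ *: _).
(* Both sums carry the same monomial: x_i x_j^k times x_i^(m-1), and x_i^(k+1) times x_i^(m-1-k)
   x_j^k, equal x_i^m x_j^k. *)
transitivity (W * 'X_i ^+ m * 'X_j ^+ k *
  (in_powers m (divided_diff i j F) * ('X_i ^+ m - 'X_j ^+ m))); last by ring.
rewrite ddE; have -> : 'X_i ^+ m = 'X_i * 'X_i ^+ m.-1 :> {mpoly C[N]}.
  by rewrite -exprS prednK.
have -> : W * in_powers m (msym (tperm i j) F) * 'X_i ^+ k.+1 *
    ('X_i ^+ (m.-1 - k) * 'X_j ^+ k)
  = W * in_powers m (msym (tperm i j) F) * 'X_i * 'X_j ^+ k * 'X_i ^+ m.-1.
  have -> : 'X_i ^+ m.-1 = 'X_i ^+ k * 'X_i ^+ (m.-1 - k) :> {mpoly C[N]}.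
    by rewrite -exprD subnKC // -ltnS prednK.
  by rewrite exprS; ring.
by ring.
Qed.

(** By its product formula f is an eigenvector of tau_i for z^(e-k), and the twist sum projects, up
    to the factor m, onto the eigenvalue z^u. Adding m in e + m - k avoids truncated subtraction. *)
Lemma twist_quotient z m i e k u f F :
    m.-primitive_root z -> (k < m)%N -> (0 < u < m)%N ->
    f * 'X_i ^+ k = 'X_[(allones *+ e)%MM] * in_powers m F ->
  exquo (twist_num z m i u f) 'X_i * 'X_i
  = (if e + m - k == u %[mod m] then m%:R else 0) *: f.
Proof.
move=> zm km hu fE; rewrite exquo_mul; last exact: twist_num_dvd.
have z0 := prim_root_neq0 zm.
have X0 : 'X_i ^+ k != 0 :> {mpoly C[N]}.
  by rewrite expf_neq0 // -[_ == 0]msupp_eq0 msuppX.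
have tauf r : tau z i r%:Z f = z ^ (r%:Z * (e + m - k)%N%:Z) *: f.
  apply: (mulIf X0); have := congr1 (tau z i r%:Z) fE.
  rewrite !tauM tau_in_powers ?(prim_expr_order zm) //.
  rewrite [in tau _ _ _ ('X_i ^+ k)]mpolyXn !tauX -mpolyXn -scalerAl -fE.
  rewrite !mulmnE mnm1E mnmE eqxx !mul1n -scalerAr.
  have -> : z ^ (r%:Z * e%:Z) =
      z ^ (r%:Z * (e + m - k)%N%:Z) * z ^ (r%:Z * k%:Z).
    rewrite -expfzDr // -mulrDr -PoszD subnK; last by lia.
    rewrite PoszD mulrDr expfzDr // [r%:Z * m%:Z]mulrC -[z ^ (m%:Z * _)]exprz_exp.
    by rewrite -[z ^ m%:Z]exprnP (prim_expr_order zm) exp1rz mulr1.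
  move=> h; apply: (scalerI (expfz_neq0 (r%:Z * k%:Z) z0)).
  by rewrite /= h -scalerAl scalerA mulrC.
rewrite /twist_num -(sum_prim_root _ _ zm) scaler_suml; apply: eq_bigr => r _.
rewrite tauf scalerA -expfzDr //; congr (z ^ _ *: _).
by rewrite PoszM mulrBr addrC.
Qed.

(** The Leibniz rule on both sides of the hypothesis, multiplied by x_i: x^(e v) yields the scalar e
    and x_i^k the scalar k, on opposite sides. *)
Lemma mderiv_step m i e k f F :
    f * 'X_i ^+ k = 'X_[(allones *+ e)%MM] * in_powers m F ->
  f^`M(i) * 'X_i ^+ k.+1 =
  'X_[(allones *+ e)%MM] *
    in_powers m (m%:R *: ('X_i * F^`M(i)) + (e%:R - k%:R) *: F).
Proof.
move=> fE; have XX : 'X_i * ('X_i ^+ k)^`M(i) = k%:R *: 'X_i ^+ k :> {mpoly C[N]}.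
  by rewrite !mpolyXn mulX_mderivX mulmnE mnm1E eqxx mul1n.
have XW : 'X_i * ('X_[(allones *+ e)%MM])^`M(i)
    = e%:R *: 'X_[(allones *+ e)%MM] :> {mpoly C[N]}.
  by rewrite mulX_mderivX mulmnE mnmE mul1n.
have XF := mulX_mderiv_in_powers m i F; have := congr1 (mderiv i) fE.
rewrite !mderivM in_powersD !in_powersZ -{}XF => /(canRL (addrK _)) dfE.
rewrite exprS mulrCA dfE mulrBr mulrDr 2![in LHS]mulrA XW.
rewrite [_ * (f * _)]mulrCA XX -scalerAr fE -scalerAl mulrDr -scalerAr.
by rewrite scalerBl mulrA ['X_[_] * 'X_i]mulrC [in RHS]addrCA addrA.
Qed.

(** The value is 0 for m | a because the twist sum in T_i starts at u = 1; kappa_0 belongs to the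
    reflections. *)
Definition twist_weight m (kappa : seq C) (a : nat) : C :=
  if (m %| a)%N then 0 else kappa`_(a %% m).

Lemma sum_twist_quotients z m (kappa : seq C) i e k f F :
    m.-primitive_root z -> (k < m)%N ->
    f * 'X_i ^+ k = 'X_[(allones *+ e)%MM] * in_powers m F ->
  (\sum_(1 <= u < m) kappa`_u *: exquo (twist_num z m i u f) 'X_i) * 'X_i
  = (m%:R * twist_weight m kappa (e + m - k)) *: f.
Proof.
move=> zm km fE; have m0 := prim_order_gt0 zm.
rewrite mulr_suml big_nat_cond.
rewrite (eq_bigr (fun u => if u == ((e + m - k) %% m)%N
                           then (m%:R * kappa`_u) *: f else 0)); last first.
  move=> u /andP[/andP[u0 um] _].
  rewrite -scalerAl (twist_quotient zm km _ fE) ?u0 // scalerA.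
  rewrite (modn_small um) eq_sym; case: eqP => _; first by rewrite mulrC.
  by rewrite mulr0 scale0r.
rewrite -big_nat_cond -big_mkcond big_nat1_eq ltn_pmod // andbT lt0n.
rewrite /twist_weight /dvdn; case: eqP => // _.
by rewrite mulr0 scale0r.
Qed.

(** The derivative and the reflections combine to L, up to the scalar e - k, which together with the
    twist sum makes c_k. *)
Lemma dunkl_step z m (kappa : m.-tuple C) i e k f F :
    m.-primitive_root z -> (k < m)%N ->
    f * 'X_i ^+ k = 'X_[(allones *+ e)%MM] * in_powers m F ->
  dunkl z kappa i f * 'X_i ^+ k.+1
  = 'X_[(allones *+ e)%MM] * in_powers m (euler m kappa`_0 i F +
      (e%:R - k%:R + m%:R * twist_weight m kappa (e + m - k)) *: F).
Proof.
move=> zm km fE; rewrite /dunkl !mulrDl (mderiv_step fE).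
have -> : (\sum_(1 <= u < m) kappa`_u *: exquo (twist_num z m i u f) 'X_i)
    * 'X_i ^+ k.+1 = (m%:R * twist_weight m kappa (e + m - k)) *:
                     ('X_[(allones *+ e)%MM] * in_powers m F).
  by rewrite exprS mulrA (sum_twist_quotients _ zm km fE) -scalerAl fE.
rewrite -scalerAl mulr_suml.
rewrite (eq_bigr (fun j => 'X_[(allones *+ e)%MM] *
   in_powers m (m%:R *: ('X_i * divided_diff i j F)))); last first.
  by move=> j ji; exact: sum_swap_quotients zm km ji fE.
have -> : \sum_(j < N | j != i) 'X_[(allones *+ e)%MM] *
      in_powers m (m%:R *: ('X_i * divided_diff i j F))
    = 'X_[(allones *+ e)%MM] *
      in_powers m (m%:R *: ('X_i * \sum_(j < N | j != i) divided_diff i j F)).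
  rewrite -mulr_sumr ['X_i * \sum_(j < N | _) _]mulr_sumr scaler_sumr.
  by rewrite /in_powers raddf_sum.
rewrite !scalerAr -!in_powersZ -!mulrDr -!in_powersD /euler.
congr (_ * in_powers m _); rewrite -[LHS]addrA addrACA -scalerDl; congr (_ + _).
by rewrite mulrDr scalerDr -!scalerAr !scalerA [kappa`_0 * _]mulrC.
Qed.

(** * Iteration of T_i and commuting factors *)

Definition euler_shift m b i F c := euler m b i F + c *: F.

(** By linearity of L, both sides equal L^2 F + (c + c') L F + c c' F. *)
Lemma euler_shiftC m b i F c c' :
  euler_shift m b i (euler_shift m b i F c) c'
  = euler_shift m b i (euler_shift m b i F c') c.
Proof.
have eulerE a : euler m b i (euler m b i F + a *: F)
    = a *: euler m b i F + euler m b i (euler m b i F).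
  by rewrite addrC euler_linear.
rewrite /euler_shift !eulerE.
move: (euler m b i F) (euler m b i _) => A B.
by rewrite -!mul_mpolyC; ring.
Qed.

Lemma foldl_euler_shift_catC m b i F (s1 s2 : seq C) :
  foldl (euler_shift m b i) F (s1 ++ s2) = foldl (euler_shift m b i) F (s2 ++ s1).
Proof.
have comm G c s : foldl (euler_shift m b i) (euler_shift m b i G c) s
    = euler_shift m b i (foldl (euler_shift m b i) G s) c.
  by elim: s G => //= c' s IH G; rewrite euler_shiftC IH.
elim: s1 F => [|c s1 IH] F /=; first by rewrite cats0.
by rewrite IH !foldl_cat /= comm.
Qed.

Definition dunkl_weight m (kappa : seq C) (e k : nat) : C :=
  e%:R - k%:R + m%:R * twist_weight m kappa (e + m - k).

Lemma iter_dunkl z m (kappa : m.-tuple C) i e k F :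
    m.-primitive_root z -> (k <= m)%N ->
  iter k (dunkl z kappa i) ('X_[(allones *+ e)%MM] * in_powers m F) * 'X_i ^+ k
  = 'X_[(allones *+ e)%MM] *
    in_powers m (foldl (euler_shift m kappa`_0 i) F (mkseq (dunkl_weight m kappa e) k)).
Proof.
move=> zm; elim: k => [|k IH] km; first by rewrite mulr1.
by rewrite mkseqS foldl_rcons /= (dunkl_step _ zm km (IH (ltnW km))).
Qed.

End DunklOnPowers.

(** * The constants c_k under the shift of kappa *)

Section Weights.
Variables (C : fieldType) (m p : nat).
Hypotheses (m_gt0 : (0 < m)%N) (p_dvd_m : (p %| m)%N).
Implicit Types kappa : (m %/ p).-tuple C.

Lemma nth_shift_param t kappa u : (u < m %/ p)%N ->
  (shift_param m p t kappa)`_u =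
  kappa`_u + (if (1 <= u <= t)%N then p%:R^-1 else 0).
Proof.
move=> un; rewrite -(tnth_nth 0 _ (Ordinal un)) tnth_mktuple (tnth_nth 0) /=.
by case: ifP; rewrite ?addr0.
Qed.

(** Since m/p divides m, reduction modulo m keeps the class modulo m/p, and multiples of m are among
    the multiples of m/p, where the full tuple also gives 0. *)
Lemma twist_weight_full_param kappa a :
  twist_weight m (full_param m p kappa) a =
  if (m %/ p %| a)%N then 0 else kappa`_(a %% (m %/ p)).
Proof.
have nm : (m %/ p %| m)%N by apply/dvdnP; exists p; rewrite mulnC divnK.
rewrite /twist_weight /dvdn -(modn_dvdm a nm).
case: eqP => [->|am]; first by rewrite mod0n.
have um : (a %% m < m)%N by rewrite ltn_pmod.
rewrite -(tnth_nth 0 (full_param m p kappa) (Ordinal um)) tnth_mktuple /=.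
by case: eqP => // _; rewrite /dvdn; case: eqP.
Qed.

Lemma full_param0 kappa : (full_param m p kappa)`_0 = kappa`_0.
Proof. by rewrite -(tnth_nth 0 _ (Ordinal m_gt0)) tnth_mktuple. Qed.

Hypothesis p_neq0 : p%:R != 0 :> C.
Local Notation n := (m %/ p)%N.

(** With n = m/p, both exponents are t - k modulo n, in the shifted range 1..t. The extra 1/p
    contributes m/p = n on the right, which makes up for the n subtracted in the index n - t + k. *)
Lemma dunkl_weight_low kappa s t k : (t < n)%N -> (k < t)%N ->
  dunkl_weight m (full_param m p kappa) (t + s * n) k =
  dunkl_weight m (full_param m p (shift_param m p t kappa)) (s * n) (n - t + k).
Proof.
move=> tn kt; rewrite /dunkl_weight !twist_weight_full_param.
have mE : m = (p * n)%N by rewrite mulnC divnK.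
have p0 : (0 < p)%N by case: (p) p_neq0 => //; rewrite eqxx.
have r1 : ((t + s * n + m - k) %% n = t - k)%N.
  have -> : (t + s * n + m - k = (s + p) * n + (t - k))%N by nia.
  by rewrite modnMDl modn_small //; lia.
have r2 : ((s * n + m - (n - t + k)) %% n = t - k)%N.
  have -> : (s * n + m - (n - t + k) = (s + p.-1) * n + (t - k))%N by nia.
  by rewrite modnMDl modn_small //; lia.
rewrite /dvdn r1 r2 subn_eq0 leqNgt kt /= nth_shift_param; last by lia.
have -> : (0 < t - k <= t)%N by lia.
have -> : m%:R = p%:R * n%:R :> C by rewrite -natrM -mE.
rewrite natrD [(n - t + k)%:R]natrD natrB ?(ltnW tn) //.
by field.
Qed.

(** The difference e - k is the same on both sides. Its residue modulo n is 0 if k = 0 and otherwise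
    n - k > t, so the shift leaves this weight alone. *)
Lemma dunkl_weight_high kappa s t k : (t < n)%N -> (k < n - t)%N ->
  dunkl_weight m (full_param m p kappa) (t + s * n) (t + k) =
  dunkl_weight m (full_param m p (shift_param m p t kappa)) (s * n) k.
Proof.
move=> tn kt; rewrite /dunkl_weight !twist_weight_full_param -addnA subnDl.
have mE : m = (p * n)%N by rewrite mulnC divnK.
have p0 : (0 < p)%N by case: (p) p_neq0 => //; rewrite eqxx.
rewrite nth_shift_param; last by rewrite ltn_pmod //; lia.
congr (_ + _ * _); first by rewrite !natrD; ring.
rewrite /dvdn; case: eqP => // nz.
suff -> : (1 <= (s * n + m - k) %% n <= t)%N = false by rewrite addr0.
have k0 : (0 < k)%N.
  case: k kt nz => // _; rewrite subn0 modnMDl => -[].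
  by rewrite [X in (X %% _)%N]mE modnMl.
have -> : (s * n + m - k = (s + p.-1) * n + (n - k))%N by nia.
by rewrite modnMDl modn_small; lia.
Qed.

Lemma dunkl_weights_rotation kappa s t : (t < n)%N ->
  exists s1 s2,
    mkseq (dunkl_weight m (full_param m p kappa) (t + s * n)) n = s1 ++ s2 /\
    mkseq (dunkl_weight m (full_param m p (shift_param m p t kappa)) (s * n)) n
      = s2 ++ s1.
Proof.
move=> tn; set c := dunkl_weight _ _ _; set c' := dunkl_weight _ _ _.
(* The first t weights on the left are the last t on the right, and the remaining n - t are the
   first on the right. *)
exists (mkseq c t), (mkseq c' (n - t)).
rewrite -{1}(subnKC (ltnW tn)) -{3}(subnK (ltnW tn)) !mkseqD.
split; congr (_ ++ _); apply/eq_in_map => k; rewrite mem_iota => /andP[_ kt].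
  exact: dunkl_weight_high.
exact/esym/dunkl_weight_low.
Qed.

End Weights.

Theorem proposition3p24 (R : realType) (m p N t s : nat)
    (hp : (1 < p)%N) (hpm : (p < m)%N) (hdvd : (p %| m)%N) (hN : (2 <= N)%N)
    (ht : (1 <= t <= m %/ p - 1)%N) (hs : (0 <= s <= p - 1)%N)
    (kappa : (m %/ p).-tuple R[i]) (g : {mpoly R[i][N]}) (i : 'I_N) :
  iter (m %/ p) (dunkl (eta R m) (full_param m p kappa) i)
    ('X_[(allones *+ (t + s * (m %/ p)))%MM] * in_powers m g)
  = 'X_[(allones *+ t)%MM] *
    iter (m %/ p)
      (dunkl (eta R m) (full_param m p (shift_param m p t kappa)) i)
      ('X_[(allones *+ (s * (m %/ p)))%MM] * in_powers m g).
Proof.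
have m0 : (0 < m)%N by lia.
have tn : (t < m %/ p)%N by lia.
have zm := eta_prim R m0; have nm := leq_div m p.
have X0 : 'X_i ^+ (m %/ p) != 0 :> {mpoly R[i][N]}.
  by rewrite expf_neq0 // -[_ == 0]msupp_eq0 msuppX.
have p0 : p%:R != 0 :> R[i] by rewrite pnatr_eq0; lia.
(* The entry kappa_0 is not shifted, so both sides involve the same L. *)
have shift0 : (shift_param m p t kappa)`_0 = kappa`_0.
  by rewrite nth_shift_param ?addr0 //; lia.
have [s1 [s2 [e1 e2]]] := dunkl_weights_rotation m0 hdvd p0 kappa s tn.
(* Multiplying by x_i^(m/p) turns both sides into products of factors L + c_k applied to g, with
   weights that differ by a rotation. *)
apply: (mulIf X0); rewrite -[RHS]mulrA.
rewrite (iter_dunkl _ i _ g zm nm) (iter_dunkl _ i _ g zm nm) e1 e2.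
rewrite (full_param0 m0 kappa) (full_param0 m0 (shift_param m p t kappa)) shift0.
rewrite [in RHS]foldl_euler_shift_catC [RHS]mulrA; congr (_ * _).
by rewrite -!mpolyXn -exprD.
Qed.
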